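(* Let $a,a',b,b'\in\mathbb{C}$, and let $M(a,a',b,b')$ be the free $\mathbb{C}[\partial]$-module with $\mathbb{C}[\partial]$-basis $\{L_i,M_i,Y_i\mid i\in\mathbb{Z}\}$, endowed with the $\lambda$-brackets determined by $$[L_i{}_\lambda L_j]=(\partial+2\lambda)L_{i+j},\quad [L_i{}_\lambda M_j]=(\partial+a\lambda+b)M_{i+j},\quad [L_i{}_\lambda Y_j]=(\partial+a'\lambda+b')Y_{i+j},\quad [Y_i{}_\lambda Y_j]=(\partial+2\lambda)M_{i+j}$$ for $i,j\in\mathbb{Z}$. Then $M(a,a',b,b')$ is a Lie conformal algebra if and only if $a'=\frac{a}{2}+1$ and $b'=\frac{b}{2}$.
   Context: A Lie conformal algebra is a $\mathbb{C}[\partial]$-module $R$ with a $\mathbb{C}$-linear map ($\lambda$-bracket) $R\otimes R\to R[\lambda]=\mathbb{C}[\lambda]\otimes R$, $x\otimes y\mapsto[x{}_\lambda y]$, such that for all $x,y,z\in R$: (conformal sesquilinearity) $[\partial x{}_\lambda y]=-\lambda[x{}_\lambda y]$ and $[x{}_\lambda\partial y]=(\partial+\lambda)[x{}_\lambda y]$; (skew-symmetry) $[x{}_\lambda y]=-[y{}_{-\lambda-\partial}x]$, where if $[y{}_\lambda x]=\sum_n\lambda^n z_n$ then $[y{}_{-\lambda-\partial}x]=\sum_n(-\lambda-\partial)^n z_n$; (Jacobi identity) $[x{}_\lambda[y{}_\mu z]]=[[x{}_\lambda y]{}_{\lambda+\mu}z]+[y{}_\mu[x{}_\lambda z]]$.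 The listed $\lambda$-brackets are the nonvanishing ones among generators: the brackets $[M_i{}_\lambda L_j]$ and $[Y_i{}_\lambda L_j]$ are those given by skew-symmetry from $[L_j{}_\lambda M_i]$ and $[L_j{}_\lambda Y_i]$, the brackets $[M_i{}_\lambda M_j]$, $[M_i{}_\lambda Y_j]$, $[Y_i{}_\lambda M_j]$ are zero, and everything is extended to the whole module by conformal sesquilinearity. *)

(* Defs.v *)
From HB Require Import structures.
From mathcomp Require Import all_boot all_order all_algebra finmap.
From mathcomp Require Import complex reals.
From mathcomp Require Import monalg.
Set Implicit Arguments.
Unset Strict Implicit.
Unset Printing Implicit Defensive.
Import GRing.Theory.
Local Open Scope ring_scope.

(* A K[∂]-module is an [lmodType {poly K}], with ['X] acting as ∂.            *)
(* For such a V, the finitely supported functions [{malg V[nat]}] are the     *)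
(* polynomials V[λ] = K[λ] ⊗ V: the coefficient [p@_n] goes with λ^n.         *)
(* Likewise [{malg V[nat * nat]}] is V[λ, μ], the key (m, n) standing for     *)
(* λ^m μ^n.                                                                   *)

Section Operators.
Variables (I : choiceType) (V : zmodType).

Definition coef_map (h : V -> V) (p : {malg V[I]}) : {malg V[I]} :=
  \sum_(k <- msupp p) << h p@_k *g k >>.

Definition shift (f : I -> I) (p : {malg V[I]}) : {malg V[I]} :=
  \sum_(k <- msupp p) << p@_k *g f k >>.

(* Substitution of the operator T of W for λ:                                 *)
(* subst T e (\sum_n λ^n v_n) = \sum_n T^n (e v_n).                           *)
Definition subst (W : zmodType) (T : W -> W) (e : V -> W)
    (p : {malg V[nat]}) : W :=
  \sum_(n <- msupp p) iter n T (e p@_n).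

End Operators.

Section LieConformal.
Variables (K : fieldType) (V : lmodType {poly K}).

Definition cscale (c : K) : {malg V[nat]} -> {malg V[nat]} :=
  coef_map (fun v => c%:P *: v).
Definition del : {malg V[nat]} -> {malg V[nat]} :=
  coef_map (fun v => 'X *: v).
Definition lam : {malg V[nat]} -> {malg V[nat]} := shift S.
Definition const (v : V) : {malg V[nat]} := << v *g 0%N >>.

Definition lam2 : {malg V[(nat * nat)%type]} -> {malg V[(nat * nat)%type]} :=
  shift (fun k => (k.1.+1, k.2)).
Definition mu2 : {malg V[(nat * nat)%type]} -> {malg V[(nat * nat)%type]} :=
  shift (fun k => (k.1, k.2.+1)).
Definition const2 (v : V) : {malg V[(nat * nat)%type]} := << v *g (0%N, 0%N) >>.

(* p(λ) |-> p(-λ-∂) *)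
Definition subst_skew (p : {malg V[nat]}) : {malg V[nat]} :=
  subst (fun q => - lam q - del q) const p.

Variable br : V -> V -> {malg V[nat]}.

Definition cbilinear : Prop :=
  (forall (c : K) x x' y,
     br (c%:P *: x + x') y = cscale c (br x y) + br x' y) /\
  (forall (c : K) x y y',
     br x (c%:P *: y + y') = cscale c (br x y) + br x y').

Definition sesquilinear : Prop :=
  (forall x y, br ('X *: x) y = - lam (br x y)) /\
  (forall x y, br x ('X *: y) = del (br x y) + lam (br x y)).

Definition skew_symmetric : Prop :=
  forall x y, br x y = - subst_skew (br y x).

Definition br_lam (x y : V) : {malg V[(nat * nat)%type]} :=
  subst lam2 const2 (br x y).
Definition br_mu (x y : V) : {malg V[(nat * nat)%type]} :=
  subst mu2 const2 (br x y).
Definition br_lam_mu (x y : V) : {malg V[(nat * nat)%type]} :=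
  subst (fun q => lam2 q + mu2 q) const2 (br x y).

Definition jacobi : Prop :=
  forall x y z,
    subst mu2 (fun u => br_lam x u) (br y z) =
    subst lam2 (fun u => br_lam_mu u z) (br x y) +
    subst lam2 (fun u => br_mu y u) (br x z).

Definition lie_conformal : Prop :=
  [/\ cbilinear, sesquilinear, skew_symmetric & jacobi].

End LieConformal.

Inductive gen := L of int | M of int | Y of int.

Definition gen_code (g : gen) : (int + int + int)%type :=
  match g with L i => inl (inl i) | M i => inl (inr i) | Y i => inr i end.
Definition gen_decode (s : (int + int + int)%type) : gen :=
  match s with inl (inl i) => L i | inl (inr i) => M i | inr i => Y i end.
Lemma gen_codeK : cancel gen_code gen_decode. Proof. by case. Qed.
HB.instance Definition _ := Choice.copy gen (can_type gen_codeK).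

Section TheAlgebra.
Variable K : fieldType.

Definition Mmod : lmodType {poly K} := {malg {poly K}[gen]}.

Implicit Types (s t : gen) (x y : Mmod).

Definition basis (s : gen) : Mmod := << 1 *g s >>.

(* (∂ + c λ + d) v *)
Definition lin (c d : K) (v : Mmod) : {malg Mmod[nat]} :=
  << ('X + d%:P) *: v *g 0%N >> + << c%:P *: v *g 1%N >>.

Definition gen_bracket (a a' b b' : K) s t : {malg Mmod[nat]} :=
  match s, t with
  | L i, L j => lin 2%:R 0 (basis (L (i + j)))
  | L i, M j => lin a b (basis (M (i + j)))
  | L i, Y j => lin a' b' (basis (Y (i + j)))
  | Y i, Y j => lin 2%:R 0 (basis (M (i + j)))
  | M i, L j => - subst_skew (lin a b (basis (M (j + i))))
  | Y i, L j => - subst_skew (lin a' b' (basis (Y (j + i))))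
  | _, _ => 0
  end.

(* f(T) q *)
Definition poly_op (T : {malg Mmod[nat]} -> {malg Mmod[nat]})
    (f : {poly K}) (q : {malg Mmod[nat]}) : {malg Mmod[nat]} :=
  \sum_(n < size f) cscale f`_n (iter n T q).

(* Sesquilinearity forces [f(∂) s _λ g(∂) t] = f(-λ) g(∂+λ) [s _λ t] on       *)
(* generators s, t.                                                           *)
Definition bracket (a a' b b' : K) x y : {malg Mmod[nat]} :=
  \sum_(s <- msupp x) \sum_(t <- msupp y)
    poly_op (fun q => - lam q) x@_s
      (poly_op (fun q => del q + lam q) y@_t (gen_bracket a a' b b' s t)).

End TheAlgebra.

(* Main.v *)
From HB Require Import structures.
Require Import Defs.
From mathcomp Require Import all_boot all_order all_algebra.
From mathcomp Require Import complex reals.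
From mathcomp Require Import finmap monalg ring.
Import GRing.Theory.
Local Open Scope ring_scope.
Local Open Scope complex_scope.

(** The proof replaces polynomials in λ and μ over the module by numbers.  An
element of M[λ], M being free over C[∂] on the generators, is a family,
indexed by the generators, of polynomials in ∂ and λ.  Since C is infinite, it
is determined by the values of these polynomials at all numbers ∂ = d, λ = l;
in place of a single coordinate one takes an arbitrary linear combination of
the coordinates, with weights F on the generators, and gets the functional
[leval l d F].  Likewise [lmeval l m d F] evaluates M[λ, μ], and the
functionals separate points ([leval_inj], [lmeval_inj]).

Under evaluation each operator of the axioms becomes a scalar or a change of
the point: λ acts as l, ∂ as d, and the substitution of -λ-∂ for λ moves
(l, d) to (-l-d, d).  Any substitution is governed by [peval_subst].
Sesquilinearity makes the bracket evaluate to
   sum over generators s, t of  x_s(-l) y_t(d+l) * (value of [s_λ t] at (l, d)),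
which is [leval_bracket]; only this formula is used afterwards.

Applying it twice, each of the three terms of the Jacobi identity becomes a
sum over triples of generators with the same weights
x_s(-l) y_r(-m) z_q(d+l+m), so that the identity holds as soon as it holds on
generators, where it is one of finitely many polynomial identities in d, l, m,
a, b, a', b' ([gen_jacobi]).  Skew-symmetry reduces to generators in the same
manner.  The only generator triples whose identity constrains the parameters
are those made of one L and two Y: for (L_0, Y_0, Y_0) it reads
   (d+l+2m)(d+al+b) = (-(l+m)+a'l+b')(d+2(l+m)) + (d+m+a'l+b')(d+2m).
At (l, m, d) = (0, 0, 1) and (1, 0, 0) this gives b = 2b' and a = 2a' - 2
([jacobi_bracket_params]), and these two equations make it an identity. *)

(** * Evaluation of module elements *)

(** Indicator weights extract a single coefficient, which is why evaluations
with arbitrary weights determine an element. *)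
Lemma mmap_delta (I : choiceType) (G : zmodType) (S : nzRingType)
    (f : {additive G -> S}) (g : {malg G[I]}) (i : I) :
  mmap f (fun k => (k == i)%:R) g = f g@_i.
Proof.
have sub : (msupp g `<=` i |` msupp g)%fset by apply: fsubsetUr.
rewrite (mmapEw sub) (big_fsetD1 i) ?fset1U1 //= eqxx mulr1.
rewrite big_seq big1 ?addr0 // => k; rewrite !inE => /andP[/negbTE-> _].
exact: mulr0.
Qed.

Section Evaluation.
Variable K : fieldType.
Local Notation Mmod := (Mmod K).
Implicit Types (d l m : K) (F : gen -> K).

(** The weights F are arbitrary, rather than the indicator of one generator,
because in a nested bracket the value of the outer bracket is, as a function of
the inner one, again an evaluation, with weights depending on the outer
argument. *)
Definition veval d F (v : Mmod) : K := mmap (horner_eval d) F v.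

Lemma veval_is_additive d F : zmod_morphism (veval d F).
Proof. exact: (@mmap_is_additive _ _ _ (horner_eval d) F). Qed.

HB.instance Definition _ d F :=
  GRing.isZmodMorphism.Build Mmod K (veval d F) (veval_is_additive d F).

Lemma vevalD d F : {morph veval d F : x y / x + y}.
Proof. exact: raddfD. Qed.

Lemma vevalE d F (v : Mmod) :
  veval d F v = \sum_(s <- msupp v) (v@_s).[d] * F s.
Proof. by []. Qed.

Lemma vevalZ d F (f : {poly K}) (v : Mmod) :
  veval d F (f *: v) = f.[d] * veval d F v.
Proof.
rewrite /veval (mmapEw (msuppZ_le f v)) mmapE mulr_sumr.
by apply: eq_bigr => s _; rewrite mcoeffZ /= horner_evalE hornerM mulrA.
Qed.

Lemma veval_basis d F s : veval d F (basis K s) = F s.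
Proof. by rewrite /veval mmapU /= horner_evalE hornerC mul1r. Qed.

Lemma eq_veval d (F G : gen -> K) (v : Mmod) :
  (forall s, F s = G s) -> veval d F v = veval d G v.
Proof. by move=> FG; apply: eq_bigr => s _; rewrite FG. Qed.

Lemma vevalN_fun d F (v : Mmod) : veval d (fun s => - F s) v = - veval d F v.
Proof. by rewrite !vevalE -sumrN; apply: eq_bigr => s _; rewrite mulrN. Qed.

Lemma vevalD_fun d (F G : gen -> K) (v : Mmod) :
  veval d (fun s => F s + G s) v = veval d F v + veval d G v.
Proof. by rewrite !vevalE -big_split; apply: eq_bigr => s _; rewrite mulrDr. Qed.

Lemma vevalZ_fun d c F (v : Mmod) :
  veval d (fun s => c * F s) v = c * veval d F v.
Proof. by rewrite !vevalE mulr_sumr; apply: eq_bigr => s _; rewrite mulrCA. Qed.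

Lemma exchange_veval (d d' : K) (F : gen -> gen -> K) (x y : Mmod) :
  veval d (fun s => veval d' (F s) y) x =
  veval d' (fun t => veval d (F^~ t) x) y.
Proof.
rewrite vevalE.
under eq_bigr do rewrite vevalE mulr_sumr.
rewrite exchange_big vevalE; apply: eq_bigr => t _ /=.
rewrite vevalE mulr_sumr; apply: eq_bigr => s _; ring.
Qed.

(** * Evaluation of polynomials over the module *)

(** The index set is left open so that M[λ] and M[λ, μ] are treated at once:
w k stands for the value of the monomial k. *)
Definition peval (I : choiceType) (w : I -> K) d F (p : {malg Mmod[I]}) : K :=
  mmap (veval d F) w p.
Arguments peval {I} w d F p.

Lemma peval_is_additive (I : choiceType) (w : I -> K) d F :
  zmod_morphism (peval w d F).
Proof. exact: (@mmap_is_additive _ _ _ (veval d F) w). Qed.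

HB.instance Definition _ (I : choiceType) (w : I -> K) d F :=
  GRing.isZmodMorphism.Build {malg Mmod[I]} K (peval w d F)
    (peval_is_additive I w d F).

Section AnyIndex.
Variables (I : choiceType) (w : I -> K) (d : K) (F : gen -> K).
Implicit Types p : {malg Mmod[I]}.

Lemma pevalE p : peval w d F p = \sum_(k <- msupp p) veval d F p@_k * w k.
Proof. by []. Qed.

Lemma pevalU v k : peval w d F << v *g k >> = veval d F v * w k.
Proof. exact: mmapU. Qed.

Lemma peval_coef_map (h : Mmod -> Mmod) (c : K) p :
  (forall v, veval d F (h v) = c * veval d F v) ->
  peval w d F (Defs.coef_map h p) = c * peval w d F p.
Proof.
move=> hE; rewrite /Defs.coef_map raddf_sum pevalE mulr_sumr.
by apply: eq_bigr => k _; rewrite /= pevalU hE mulrA.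
Qed.

Lemma peval_shift (f : I -> I) t p :
  (forall k, w (f k) = t * w k) ->
  peval w d F (shift f p) = t * peval w d F p.
Proof.
move=> wf; rewrite /shift raddf_sum pevalE mulr_sumr.
by apply: eq_bigr => k _; rewrite /= pevalU wf; ring.
Qed.

End AnyIndex.

Definition leval l d F (p : {malg Mmod[nat]}) : K :=
  peval (fun n => l ^+ n) d F p.

Lemma leval_is_additive l d F : zmod_morphism (leval l d F).
Proof. exact: raddfB. Qed.

HB.instance Definition _ l d F :=
  GRing.isZmodMorphism.Build {malg Mmod[nat]} K (leval l d F)
    (leval_is_additive l d F).

Lemma levalN l d F : {morph leval l d F : p / - p}.
Proof. exact: raddfN. Qed.

Lemma levalD l d F : {morph leval l d F : p q / p + q}.
Proof. exact: raddfD. Qed.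

Definition lmeval l m d F (p : {malg Mmod[(nat * nat)%type]}) : K :=
  peval (fun k => l ^+ k.1 * m ^+ k.2) d F p.

Lemma lmeval_is_additive l m d F : zmod_morphism (lmeval l m d F).
Proof. exact: raddfB. Qed.

HB.instance Definition _ l m d F :=
  GRing.isZmodMorphism.Build {malg Mmod[(nat * nat)%type]} K (lmeval l m d F)
    (lmeval_is_additive l m d F).

Lemma lmevalD l m d F : {morph lmeval l m d F : p q / p + q}.
Proof. exact: raddfD. Qed.

(** A functional for which T acts as the scalar t turns the substitution of T
for λ into evaluation at λ = t.  The functional may be any one on the target:
this covers the skew substitution as well as the three nested brackets of the
Jacobi identity. *)
Lemma peval_subst (W : zmodType) (phi : {additive W -> K})
    (T : W -> W) (e : Mmod -> W) t d F p :
  (forall u, phi (T u) = t * phi u) ->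
  (forall v, phi (e v) = veval d F v) ->
  phi (subst T e p) = leval t d F p.
Proof.
move=> phiT phie; rewrite /subst raddf_sum /leval pevalE.
apply: eq_bigr => n _ /=; rewrite -phie mulrC; move: (e _) => u.
by elim: n => [|n IHn]; rewrite ?expr0 ?mul1r //= phiT IHn exprS mulrA.
Qed.

Lemma leval_cscale l d F c p : leval l d F (cscale c p) = c * leval l d F p.
Proof. by apply: peval_coef_map => v; rewrite vevalZ hornerC. Qed.

Lemma leval_lam l d F p : leval l d F (lam p) = l * leval l d F p.
Proof. by apply: peval_shift => n; rewrite exprS. Qed.

Lemma leval_del l d F p : leval l d F (del p) = d * leval l d F p.
Proof. by apply: peval_coef_map => v; rewrite vevalZ hornerX. Qed.

(** On values at (l, d) the operator -λ-∂ is the scalar -l-d. *)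
Lemma leval_subst_skew l d F p :
  leval l d F (subst_skew p) = leval (- l - d) d F p.
Proof.
apply: peval_subst => [q | v] /=; last by rewrite /leval pevalU mulr1.
by rewrite raddfB raddfN /= leval_lam leval_del; ring.
Qed.

Lemma leval_lin l d F c e v :
  leval l d F (lin c e v) = (d + c * l + e) * veval d F v.
Proof.
rewrite /leval /lin raddfD /= !pevalU !vevalZ hornerD hornerX !hornerC.
by rewrite expr0 expr1; ring.
Qed.

Lemma lmeval_lam2 l m d F p : lmeval l m d F (lam2 p) = l * lmeval l m d F p.
Proof. by apply: peval_shift => k /=; rewrite exprS mulrA. Qed.

Lemma lmeval_mu2 l m d F p : lmeval l m d F (mu2 p) = m * lmeval l m d F p.
Proof. by apply: peval_shift => k /=; rewrite exprS mulrCA. Qed.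

Lemma lmeval_const2 l m d F v : lmeval l m d F (const2 v) = veval d F v.
Proof. by rewrite /lmeval pevalU !mulr1. Qed.

Lemma leval_poly_op l d F T t (f : {poly K}) q :
  (forall u, leval l d F (T u) = t * leval l d F u) ->
  leval l d F (poly_op T f q) = f.[t] * leval l d F q.
Proof.
move=> Tt; rewrite /poly_op raddf_sum horner_coef mulr_suml.
apply: eq_bigr => n _ /=; rewrite leval_cscale -mulrA; congr (_ * _).
elim: (nat_of_ord n) => [|k IHk]; first by rewrite mul1r.
by rewrite /= Tt IHk exprS mulrA.
Qed.

(** * Evaluations separate points in characteristic zero *)

Section CharacteristicZero.
Hypothesis natr_inj : injective (GRing.natmul (1 : K)).

(** In characteristic zero the images of the natural numbers give more roots
than the degree allows. *)
Lemma poly0_of_horner (f : {poly K}) : (forall t, f.[t] = 0) -> f = 0.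
Proof.
move=> f0; apply/eqP/negPn/negP => fN0.
pose rs := [seq n%:R : K | n <- iota 0 (size f)].
have: (size rs < size f)%N.
  apply: max_poly_roots => //.
    by apply/allP => t _; rewrite /root f0.
  by rewrite map_inj_uniq ?iota_uniq.
by rewrite size_map size_iota ltnn.
Qed.

(** One variable is eliminated at a time: an expression vanishing at every l is
a polynomial in l with zero coefficients.  The factor w carries whatever has
been done with the other variables. *)
Lemma peval_coef0 (I : choiceType) (w : I -> K) (e : I -> nat) d F p :
  (forall l, peval (fun k => w k * l ^+ e k) d F p = 0) ->
  forall n, peval (fun k => w k * (e k == n)%:R) d F p = 0.
Proof.
move=> p0 n.
pose g := \sum_(k <- msupp p) (veval d F p@_k * w k) *: 'X^(e k).
have g0 : g = 0.
  apply: poly0_of_horner => l; rewrite -(p0 l) horner_sum.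
  by apply: eq_bigr => k _; rewrite hornerZ hornerXn mulrA.
have: g`_n = 0 by rewrite g0 coef0.
rewrite coef_sum => <-; apply: eq_bigr => k _.
by rewrite coefZ coefXn eq_sym mulrA.
Qed.

Lemma eq_peval (I : choiceType) (w w' : I -> K) d F p :
  w =1 w' -> peval w d F p = peval w' d F p.
Proof. by move=> ww'; apply: eq_bigr => k _; rewrite ww'. Qed.

Lemma peval_delta_inj (I : choiceType) (p : {malg Mmod[I]}) :
  (forall k d F, peval (fun i => (i == k)%:R) d F p = 0) -> p = 0.
Proof.
move=> p0; apply/malgP => k; rewrite mcoeff0; apply/malgP => s.
rewrite mcoeff0; apply: poly0_of_horner => d.
have := p0 k d (fun t => (t == s)%:R).
by rewrite /peval mmap_delta /= /veval mmap_delta.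
Qed.

Lemma leval_inj p q :
  (forall l d F, leval l d F p = leval l d F q) -> p = q.
Proof.
move=> pq; apply/eqP; rewrite -subr_eq0; apply/eqP.
apply: peval_delta_inj => n d F.
rewrite -[RHS](@peval_coef0 _ (fun=> 1) id d F (p - q) _ n).
  by apply: eq_peval => k; rewrite mul1r.
move=> l; transitivity (leval l d F (p - q)).
  by apply: eq_peval => k; rewrite mul1r.
by rewrite raddfB /= pq subrr.
Qed.

Lemma lmeval_inj p q :
  (forall l m d F, lmeval l m d F p = lmeval l m d F q) -> p = q.
Proof.
move=> pq; apply/eqP; rewrite -subr_eq0; apply/eqP.
apply: peval_delta_inj => -[i j] d F.
(* First λ is eliminated at a fixed value of μ, and then μ. *)
rewrite -[RHS](@peval_coef0 _ (fun k => (k.1 == i)%:R) snd d F (p - q) _ j).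
  by apply: eq_peval => -[i' j'] /=; rewrite -pair_eqE -mulnb natrM.
move=> m; transitivity (peval (fun k => m ^+ k.2 * (k.1 == i)%:R) d F (p - q)).
  by apply: eq_peval => k; rewrite mulrC.
apply: peval_coef0 => l.
transitivity (lmeval l m d F (p - q)).
  by apply: eq_peval => k; rewrite mulrC.
by rewrite raddfB /= pq subrr.
Qed.
End CharacteristicZero.

(** * Values of the bracket *)

Lemma exchange_leval l d d' (H : gen -> gen -> K) p (x : Mmod) :
  leval l d (fun t => veval d' (H t) x) p =
  veval d' (fun s => leval l d (fun t => H t s) p) x.
Proof.
rewrite /leval pevalE.
under eq_bigr do rewrite exchange_veval vevalE mulr_suml.
rewrite exchange_big; apply: eq_bigr => s _ /=.
by rewrite pevalE mulr_sumr; apply: eq_bigr => n _; rewrite mulrA.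
Qed.

Section Bracket.
Variables a a' b b' : K.
Local Notation gbr := (gen_bracket a a' b b').

(** Sesquilinearity: ∂ acts on the left argument as -λ and on the right one as
∂+λ, whence the points -l and d+l. *)
Lemma leval_bracket l d F (x y : Mmod) :
  leval l d F (bracket a a' b b' x y) =
  veval (- l) (fun s => veval (d + l) (fun t => leval l d F (gbr s t)) y) x.
Proof.
rewrite /bracket raddf_sum vevalE; apply: eq_bigr => s _ /=.
rewrite raddf_sum vevalE mulr_sumr; apply: eq_bigr => t _ /=.
rewrite (@leval_poly_op _ _ _ _ (- l)); last first.
  by move=> u; rewrite raddfN /= leval_lam mulNr.
rewrite (@leval_poly_op _ _ _ _ (d + l)) // => u.
by rewrite raddfD /= leval_lam leval_del mulrDl.
Qed.

Lemma leval_gen_bracket l d F s t :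
  leval l d F (gbr s t) =
  match s, t with
  | L i, L j => (d + 2 * l) * F (L (i + j))
  | L i, M j => (d + a * l + b) * F (M (i + j))
  | L i, Y j => (d + a' * l + b') * F (Y (i + j))
  | Y i, Y j => (d + 2 * l) * F (M (i + j))
  | M i, L j => - (d + a * (- l - d) + b) * F (M (j + i))
  | Y i, L j => - (d + a' * (- l - d) + b') * F (Y (j + i))
  | _, _ => 0
  end.
Proof.
case: s t => i [] j /=; rewrite ?raddf0 // ?raddfN /= ?leval_subst_skew.
all: by rewrite leval_lin veval_basis; ring.
Qed.

Lemma leval_gen_skew l d F s t :
  leval (- l - d) d F (gbr t s) = - leval l d F (gbr s t).
Proof.
rewrite !leval_gen_bracket.
by case: s t => i [] j; rewrite ?oppr0 // ?[j + i]addrC; ring.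
Qed.

(** The points at which the inner brackets are evaluated come from
sesquilinearity of the outer one: an inner bracket in its right argument is
seen at ∂ = d+l (or d+m), one in its left argument at ∂ = -(l+m). *)
Lemma gen_jacobi l m d F s r q : a' = a / 2 + 1 -> b' = b / 2 ->
    2 != 0 :> K ->
  leval m (d + l) (fun t => leval l d F (gbr s t)) (gbr r q) =
  leval l (- (l + m)) (fun t => leval (l + m) d F (gbr t q)) (gbr s r) +
  leval l (d + m) (fun t => leval m d F (gbr r t)) (gbr s q).
Proof.
move=> a'E b'E two_neq0.
have aE : a = 2 * a' - 2 by rewrite a'E; field.
have bE : b = 2 * b' by rewrite b'E; field.
rewrite !leval_gen_bracket; case: s r q => i [] j [] k.
all: rewrite ?leval_gen_bracket ?mulr0 ?addr0 //.
(* The products of generators differ only in how their indices are added up: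
   CE and AE normalise these sums to i + j + k. *)
all: have CE : ((j + i = i + j) * (k + i = i + k) * (k + j = j + k))
  by do !split; ring.
all: have AE : ((i + (j + k) = i + j + k) * (j + k + i = i + j + k) *
  (k + (i + j) = i + j + k) * (i + k + j = i + j + k) *
  (j + (i + k) = i + j + k)) by do !split; ring.
all: rewrite ?CE ?AE.
all: move: (F _) => f.
all: rewrite ?aE ?bE; ring.
Qed.

(** * The axioms of a Lie conformal algebra *)

(** The bracket is abstracted from its defining sums: the axioms depend only on
its values. *)
Section BracketByValues.
Variable br : Mmod -> Mmod -> {malg Mmod[nat]}.
Hypothesis leval_br : forall l d F x y,
  leval l d F (br x y) =
  veval (- l) (fun s => veval (d + l) (fun t => leval l d F (gbr s t)) y) x.

Lemma lmeval_br_lam l m d F x u :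
  lmeval l m d F (br_lam br x u) = leval l d F (br x u).
Proof.
by apply: peval_subst => v /=; rewrite (lmeval_lam2, lmeval_const2).
Qed.

Lemma lmeval_br_mu l m d F x u :
  lmeval l m d F (br_mu br x u) = leval m d F (br x u).
Proof.
by apply: peval_subst => v /=; rewrite (lmeval_mu2, lmeval_const2).
Qed.

Lemma lmeval_br_lam_mu l m d F x u :
  lmeval l m d F (br_lam_mu br x u) = leval (l + m) d F (br x u).
Proof.
apply: peval_subst => v /=; last exact: lmeval_const2.
by rewrite raddfD /= lmeval_lam2 lmeval_mu2 mulrDl.
Qed.

(** Values of a trilinear expression [x_λ y_μ z] from its values on generators.
The points are those prescribed by sesquilinearity; all three terms of the
Jacobi identity have this form, so that they can be compared generator by
generator. *)
Definition veval3 l m d (H : gen -> gen -> gen -> K) (x y z : Mmod) : K :=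
  veval (- l)
    (fun s => veval (- m) (fun r => veval (d + l + m) (H s r) z) y) x.

Lemma eq_veval3 l m d G H x y z :
  (forall s r q, G s r q = H s r q) ->
  veval3 l m d G x y z = veval3 l m d H x y z.
Proof.
by move=> GH; do 3![apply: eq_veval => ?]; apply: GH.
Qed.

Lemma veval3D l m d G H x y z :
  veval3 l m d G x y z + veval3 l m d H x y z =
  veval3 l m d (fun s r q => G s r q + H s r q) x y z.
Proof.
rewrite /veval3 -vevalD_fun; apply: eq_veval => s.
by rewrite -vevalD_fun; apply: eq_veval => r; rewrite -vevalD_fun.
Qed.

(** In each of the next three lemmas, G is the outer bracket seen as weights on
the generators occurring in the inner one. *)
Lemma lmeval_jacobi_xyz l m d F x y z :
  lmeval l m d F (subst (@mu2 K Mmod) (fun u => br_lam br x u) (br y z)) =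
  veval3 l m d (fun s r q =>
    leval m (d + l) (fun t => leval l d F (gbr s t)) (gbr r q)) x y z.
Proof.
pose G t := veval (- l) (fun s => leval l d F (gbr s t)) x.
rewrite (@peval_subst _ _ _ _ m (d + l) G) => [|u|u] /=.
- rewrite leval_br /veval3 [RHS]exchange_veval; apply: eq_veval => r.
  by rewrite [RHS]exchange_veval; apply: eq_veval => q; rewrite exchange_leval.
- exact: lmeval_mu2.
- by rewrite lmeval_br_lam leval_br exchange_veval.
Qed.

Lemma lmeval_jacobi_xy_z l m d F x y z :
  lmeval l m d F (subst (@lam2 K Mmod) (fun u => br_lam_mu br u z) (br x y)) =
  veval3 l m d (fun s r q =>
    leval l (- (l + m)) (fun t => leval (l + m) d F (gbr t q)) (gbr s r)) x y z.
Proof.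
pose G t := veval (d + (l + m)) (fun q => leval (l + m) d F (gbr t q)) z.
rewrite (@peval_subst _ _ _ _ l (- (l + m)) G) => [|u|u] /=.
- rewrite leval_br /veval3 opprD [- l - m]addrC addrNK.
  apply: eq_veval => s; apply: eq_veval => r.
  by rewrite exchange_leval addrA.
- exact: lmeval_lam2.
- by rewrite lmeval_br_lam_mu leval_br.
Qed.

Lemma lmeval_jacobi_y_xz l m d F x y z :
  lmeval l m d F (subst (@lam2 K Mmod) (fun u => br_mu br y u) (br x z)) =
  veval3 l m d (fun s r q =>
    leval l (d + m) (fun t => leval m d F (gbr r t)) (gbr s q)) x y z.
Proof.
pose G t := veval (- m) (fun r => leval m d F (gbr r t)) y.
rewrite (@peval_subst _ _ _ _ l (d + m) G) => [|u|u] /=.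
- rewrite leval_br /veval3 addrAC; apply: eq_veval => s.
  by rewrite [RHS]exchange_veval; apply: eq_veval => q; rewrite exchange_leval.
- exact: lmeval_lam2.
- by rewrite lmeval_br_mu leval_br exchange_veval.
Qed.

Section LieConformal.
Hypothesis natr_inj : injective (GRing.natmul (1 : K)).

Lemma cbilinear_bracket : cbilinear br.
Proof.
split=> c x y z; apply: (leval_inj natr_inj) => l d F;
  rewrite levalD leval_cscale !leval_br.
  by rewrite vevalD vevalZ hornerC.
rewrite -vevalZ_fun -vevalD_fun; apply: eq_veval => s.
by rewrite vevalD vevalZ hornerC.
Qed.

Lemma sesquilinear_bracket : sesquilinear br.
Proof.
split=> x y; apply: (leval_inj natr_inj) => l d F.
  by rewrite levalN leval_lam !leval_br vevalZ hornerX mulNr.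
rewrite levalD leval_lam leval_del !leval_br -mulrDl -vevalZ_fun.
by apply: eq_veval => s; rewrite vevalZ hornerX.
Qed.

Lemma skew_symmetric_bracket : skew_symmetric br.
Proof.
move=> x y; apply: (leval_inj natr_inj) => l d F.
rewrite levalN leval_subst_skew !leval_br [in RHS]exchange_veval.
have -> : d + (- l - d) = - l by ring.
have -> : - (- l - d) = d + l by ring.
rewrite -vevalN_fun; apply: eq_veval => s.
by rewrite -vevalN_fun; apply: eq_veval => t; rewrite leval_gen_skew opprK.
Qed.

Lemma jacobi_bracket : a' = a / 2 + 1 -> b' = b / 2 -> jacobi br.
Proof.
move=> a'E b'E x y z; apply: (lmeval_inj natr_inj) => l m d F.
rewrite lmevalD lmeval_jacobi_xyz lmeval_jacobi_xy_z lmeval_jacobi_y_xz.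
rewrite veval3D; apply: eq_veval3 => s r q; apply: gen_jacobi => //.
by rewrite -[0]/(0%:R) (inj_eq natr_inj).
Qed.
End LieConformal.

(** The triple (L_0, Y_0, Y_0) is where the λ-brackets with parameters a, b and
a', b' meet, through [Y_λ Y] = (∂+2λ)M. *)
Lemma jacobi_bracket_params : 2 != 0 :> K -> jacobi br ->
  a' = a / 2 + 1 /\ b' = b / 2.
Proof.
move=> two_neq0 /(_ (basis K (L 0)) (basis K (Y 0)) (basis K (Y 0))) jac.
have E l m d : (d + l + 2 * m) * (d + a * l + b) =
    (- (l + m) + a' * l + b') * (d + 2 * (l + m)) +
    (d + m + a' * l + b') * (d + 2 * m).
  have := congr1 (lmeval l m d (fun=> 1)) jac.
  rewrite lmevalD lmeval_jacobi_xyz lmeval_jacobi_xy_z lmeval_jacobi_y_xz.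
  by rewrite /veval3 !veval_basis !leval_gen_bracket !mulr1.
(* Values at (l, m, d) = (0, 0, 1) and (1, 0, 0) suffice. *)
have bE : b = 2 * b'.
  transitivity ((1 + 0 + 2 * 0) * (1 + a * 0 + b) - 1); first by ring.
  by rewrite E; ring.
have aE : a = 2 * a' - 2.
  transitivity ((0 + 1 + 2 * 0) * (0 + a * 1 + b) - b); first by ring.
  by rewrite E bE; ring.
by rewrite aE bE; split; field.
Qed.

End BracketByValues.
End Bracket.
End Evaluation.

Theorem theorem2p3 (R : realType) (a a' b b' : R[i]) :
  lie_conformal (bracket a a' b b') <-> a' = a / 2%:R + 1 /\ b' = b / 2%:R.
Proof.
have natr_inj : injective (GRing.natmul (1 : R[i])).
  by apply: Num.Theory.mulrIn; apply: oner_neq0.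
have two_neq0 : 2 != 0 :> R[i] by rewrite Num.Theory.pnatr_eq0.
have brE := @leval_bracket _ a a' b b'.
split=> [[_ _ _ jac] | [a'E b'E]].
  exact: jacobi_bracket_params brE two_neq0 jac.
split.
- exact: cbilinear_bracket brE natr_inj.
- exact: sesquilinear_bracket brE natr_inj.
- exact: skew_symmetric_bracket brE natr_inj.
- exact: jacobi_bracket brE natr_inj a'E b'E.
Qed.
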